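(* Let $P$ be a plant and $Q$ a specification. The time complexity of the integrated symbolic control design algorithm described in the context is $$O\bigl(\max\{\operatorname{card}([X_q\cap X_p]_{2\eta})\cdot\operatorname{card}([U_p]_{2\mu}),\ \operatorname{card}([X_q\cap X_p]_{2\eta})^2\}\bigr).$$
   Context: $\|\cdot\|$ is the infinity norm on $\mathbb R^n$. A control system is $\Sigma=(X,X_0,U,\mathcal U,f)$ with $X\subseteq\mathbb R^n$, $X_0\subseteq X$, $U\subseteq\mathbb R^m$, $\mathcal U$ a subset of the locally essentially bounded functions from intervals $]a,b[$ ($a<0<b$) to $U$, and $f:\mathbb R^n\times U\to\mathbb R^n$ continuous and Lipschitz in $x$ on compact sets uniformly in $u\in U$. A trajectory is a curve $\xi$ with $\dot\xi=f(\xi,u)$ a.e.; $\xi_{xu}(\tau)$ is the point reached at time $\tau$ from $x$ under $u$. Forward complete: every trajectory is defined on an interval $]a,\infty[$. $\Sigma$ is $\delta$-ISS if it is forward complete and $\|\xi_{xu}(t)-\xi_{x'u'}(t)\|\le\beta(\|x-x'\|,t)+\gamma(\|u-u'\|_\infty)$ for all $t\ge0$, $x,x'\in\mathbb R^n$, $u,u'\in\mathcal U$, for some continuous $\gamma$ strictly increasing, unbounded with $\gamma(0)=0$ ($\mathcal K_\infty$) and some continuous $\beta$ with $\beta(\cdot,s)\in\mathcal K_\infty$ and $\beta(r,\cdot)$ decreasing to $0$ ($\mathcal{KL}$). Setting. $P=(X_p,X_{p,0},U_p,\mathcal U_p,f_p)$ is a control system; $Q=(X_q,X_{q,0},U_q,\mathcal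 U_q,f_q)$ is an autonomous system $\dot x=g_q(x)$, viewed as a control system with $U_q=\{0\}$ and only the null input. $X_p$, $U_p$, $X_q$ are bounded. $P$ and $Q$ are $\delta$-ISS with functions $\beta_p,\gamma_p$ and $\beta_q$. Given $\varepsilon>0$, parameters $\theta_p,\theta_q,\tau,\eta,\mu>0$ satisfy $\theta_p+\theta_q\le\varepsilon$, $\beta_p(\theta_p,\tau)+\gamma_p(\mu)+\eta\le\theta_p$, $\beta_q(\theta_q,\tau)+\eta\le\theta_q$. $[A]_\mu=\{a\in A:a_i=k_i\mu,\ k_i\in\mathbb Z\}$; $\mathcal B_{[\eta[}(y)=\prod_i[y_i-\eta,y_i+\eta[$. The symbolic system $S_{\tau,\eta,\mu}(\Sigma)$ has states $[X]_{2\eta}$, inputs $[U]_{2\mu}$ (as constant inputs on $[0,\tau]$), and transitions $x\xrightarrow{u}y$ iff $\xi_{xu}(\tau)\in\mathcal B_{[\eta[}(y)\cap X$ (so there is at most one successor $y$ for each $x,u$). Put $S_p=S_{\tau,\eta,\mu}(P)$, $S_q=S_{\tau,\eta,0}(Q)$, where for $Q$, $\mu=0$ means the input set is $\{0\}$. Algorithm. For a set $T$ of triples, $\mathbf X_{source}(T)=\{x:\exists u,y,\ (x,u,y)\in T\}$. Initialize $X_0:=[X_{p,0}\cap X_{q,0}]_{2\eta}$, $\mathbf X_{target}:=X_0$, $T:=\varnothing$, $Bad:=\varnothing$. While there is $x\in[X_p\cap X_q]_{2\eta}$ with $x\in\mathbf X_{target}\setminus(\mathbf X_{source}(T)\cup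 Bad)$, take such an $x$ and: compute the successor $y$ of $x$ in $S_q$; if $y$ exists and $y\notin Bad$, run through the inputs $u\in[U_p]_{2\mu}$, computing the $u$-successor $z$ of $x$ in $S_p$, stopping as soon as some $u$ gives $z=y$; if such $u$ is found, add $(x,u,y)$ to $T$ and $y$ to $\mathbf X_{target}$. Otherwise (no $y$, or $y\in Bad$, or no such $u$) set $(T,Bad):=\mathbf{NonBlock}(T,x,Bad)$. Function $\mathbf{NonBlock}(T,x,Bad)$: set $Badx:=\{x\}$; while $Badx\ne\varnothing$ take $y\in Badx$; for each $z\in\mathbf X_{source}(T)$, if $(z,u,y)\in T$ for some $u$, remove this triple from $T$ and add $z$ to $Badx$; then remove $y$ from $Badx$ and add $y$ to $Bad$; finally return $(T,Bad)$. The output is the system with states $\mathbf X_{source}(T)$, initial states $X_0\cap\mathbf X_{source}(T)$, inputs $[U_p]_{2\mu}$ and transitions $T$. Time complexity is the number of basic steps: each processing of a state $x$ in the main loop, each input $u$ tried for a state $x$, each selection of a $y$ in $\mathbf{NonBlock}$ and each test of a pair $(y,z)$ in $\mathbf{NonBlock}$ count as one step (successor computations, membership tests and elementary set updates having unit cost). The $O(\cdot)$ is a worst-case bound with absolute implied constant. *)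

(* Defs.v *)
From HB Require Import structures.
From mathcomp Require Import all_boot all_order all_algebra finmap.
From mathcomp Require Import all_classical all_reals all_analysis ess_sup_inf.

Set Implicit Arguments.
Unset Strict Implicit.
Unset Printing Implicit Defensive.

Import Order.TTheory GRing.Theory Num.Theory.
Import numFieldNormedType.Exports.
Local Open Scope classical_set_scope.
Local Open Scope ring_scope.

(* R^n is 'rV[R]_n; its library norm `|x| is the infinity norm. *)

Definition oitv (R : realType) (a b : \bar R) : set R :=
  [set t | (a < t%:E)%E /\ (t%:E < b)%E].

(* A curve defined on ]in_lo, in_hi[; the values of in_fun outside of this
   interval are irrelevant. *)
Record input (R : realType) (m : nat) := Input {
  in_lo : \bar R ;
  in_hi : \bar R ;
  in_fun : R -> 'rV[R]_m }.

Definition in_dom (R : realType) (m : nat) (v : input R m) : set R :=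
  oitv (in_lo v) (in_hi v).

(* The library's measurable functions are the Borel ones; a Lebesgue measurable
   function is one that is a.e. equal to a Borel function. *)
Definition locally_ess_bounded (R : realType) (m : nat) (v : input R m) : Prop :=
  (forall j : 'I_m, exists2 g : R -> R, measurable_fun setT g &
     {ae lebesgue_measure, forall t : R, in_dom v t -> in_fun v t ord0 j = g t}) /\
  (forall c d : R, `[c, d]%classic `<=` in_dom v -> exists M : R,
     {ae lebesgue_measure, forall t : R, `[c, d]%classic t -> `|in_fun v t| <= M}).

Record control_system (R : realType) (n m : nat) := ControlSystem {
  state_space : set 'rV[R]_n ;
  init_space : set 'rV[R]_n ;
  input_values : set 'rV[R]_m ;
  input_curves : set (input R m) ;
  vfield : 'rV[R]_n -> 'rV[R]_m -> 'rV[R]_n ;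
  init_sub : init_space `<=` state_space ;
  input_curvesP : forall v, input_curves v ->
    [/\ (in_lo v < 0)%E, (0 < in_hi v)%E,
        (forall t, in_dom v t -> input_values (in_fun v t)) &
        locally_ess_bounded v] ;
  vfield_continuous :
    {within [set p : 'rV[R]_n * 'rV[R]_m | input_values p.2],
      continuous (fun p => vfield p.1 p.2)} ;
  vfield_lipschitz : forall K : set 'rV[R]_n, compact K ->
    exists L : R, forall u, input_values u -> L.-lipschitz_K (vfield^~ u) }.

Definition abs_continuous_on (R : realType) (n : nat) (c d : R)
    (xi : R -> 'rV[R]_n) : Prop :=
  forall e : R, 0 < e -> exists2 delta : R, 0 < delta &
    forall (k : nat) (l r : 'I_k -> R),
      (forall i, [/\ c <= l i, l i <= r i & r i <= d]) ->
      (forall i j, i != j -> r i <= l j \/ r j <= l i) ->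
      \sum_i (r i - l i) < delta ->
      \sum_i `|xi (r i) - xi (l i)| < e.

(* xi is a (Caratheodory) solution of xi' = f(xi, v) on ]a, b[. The input v
   need not belong to the input curves of Sigma: the symbolic system below uses
   constant inputs. *)
Definition trajectory (R : realType) (n m : nat) (Sigma : control_system R n m)
    (v : input R m) (a b : \bar R) (xi : R -> 'rV[R]_n) : Prop :=
  [/\ (a < 0)%E /\ (0 < b)%E,
      oitv a b `<=` in_dom v,
      (forall c d : R, `[c, d]%classic `<=` oitv a b ->
         abs_continuous_on c d xi) &
      {ae lebesgue_measure, forall t : R, oitv a b t ->
         is_derive t (1 : R) xi (vfield Sigma (xi t) (in_fun v t))}].

(* z = xi_{x v}(t). As the vector field is Lipschitz in the state on compact
   sets, there is at most one such z. *)
Definition reaches (R : realType) (n m : nat) (Sigma : control_system R n m)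
    (x : 'rV[R]_n) (v : input R m) (t : R) (z : 'rV[R]_n) : Prop :=
  exists (a b : \bar R) (xi : R -> 'rV[R]_n),
    [/\ trajectory Sigma v a b xi, oitv a b t, xi 0 = x & xi t = z].

(* Since the restriction of a trajectory to a smaller interval is again a
   trajectory, being defined on ]a, +oo[ means: there is a solution on such an
   interval from every state and for every input curve, and every trajectory
   extends to one defined on such an interval. *)
Definition forward_complete (R : realType) (n m : nat)
    (Sigma : control_system R n m) : Prop :=
  forall v, input_curves Sigma v ->
    (forall x, exists (a : \bar R) (xi : R -> 'rV[R]_n),
       trajectory Sigma v a +oo%E xi /\ xi 0 = x) /\
    (forall a b xi, trajectory Sigma v a b xi ->
       exists2 zeta, trajectory Sigma v a +oo%E zeta &
         forall t, oitv a b t -> zeta t = xi t).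

Definition class_Kinf (R : realType) (gamma : R -> R) : Prop :=
  [/\ {within `[0, +oo[, continuous gamma},
      {in `[0, +oo[ &, {homo gamma : r s / r < s}},
      (forall M : R, exists2 r : R, 0 <= r & M < gamma r) &
      gamma 0 = 0].

Definition class_KL (R : realType) (beta : R -> R -> R) : Prop :=
  [/\ {within [set p : R * R | 0 <= p.1 /\ 0 <= p.2],
        continuous (fun p => beta p.1 p.2)},
      (forall s, 0 <= s -> class_Kinf (beta^~ s)) &
      forall r, 0 <= r ->
        {in `[0, +oo[ &, {homo beta r : s t /~ s <= t}} /\
        beta r s @[s --> +oo] --> 0].

(* ess sup over t >= 0 of `|v t - w t|; possibly +oo. *)
Definition input_dist (R : realType) (m : nat) (v w : input R m) : \bar R :=
  ess_sup lebesgue_measure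
    ((fun t : R => `|in_fun v t - in_fun w t|%:E) \_ `[0, +oo[).

(* When the distance of the inputs is +oo, the bound is void, gamma being
   unbounded. *)
Definition delta_ISS_with (R : realType) (n m : nat)
    (Sigma : control_system R n m) (beta : R -> R -> R) (gamma : R -> R) : Prop :=
  [/\ forward_complete Sigma, class_KL beta, class_Kinf gamma &
      forall v w, input_curves Sigma v -> input_curves Sigma w ->
      forall (x y p q : 'rV[R]_n) (t r : R), 0 <= t ->
        reaches Sigma x v t p -> reaches Sigma y w t q ->
        input_dist v w = r%:E ->
        `|p - q| <= beta `|x - y| t + gamma r].

Definition const_input (R : realType) (m : nat) (u : 'rV[R]_m) : input R m :=
  Input -oo%E +oo%E (fun=> u).

(* x' = g(x), with g := vfield Sigma ^~ 0. *)
Definition autonomous (R : realType) (n m : nat) (Sigma : control_system R n m)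
    : Prop :=
  input_values Sigma = [set 0] /\ input_curves Sigma = [set const_input 0].


Record system (S I : Type) := System {
  states : set S ;
  initial : set S ;
  inputs : set I ;
  trans : S -> I -> S -> Prop }.

(* [A]_mu; in particular [{0}]_0 = {0}. *)
Definition lattice_points (R : realType) (n : nat) (mu : R) (A : set 'rV[R]_n)
    : set 'rV[R]_n :=
  [set a | A a /\ forall i, exists k : int, a ord0 i = k%:~R * mu].

Definition half_open_box (R : realType) (n : nat) (eta : R) (y : 'rV[R]_n)
    : set 'rV[R]_n :=
  [set z | forall i, y ord0 i - eta <= z ord0 i /\ z ord0 i < y ord0 i + eta].

Definition symbolic_system (R : realType) (n m : nat) (tau eta mu : R)
    (Sigma : control_system R n m) : system 'rV[R]_n 'rV[R]_m := {|
  states := lattice_points (2 * eta) (state_space Sigma) ;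
  initial := lattice_points (2 * eta) (init_space Sigma) ;
  inputs := lattice_points (2 * mu) (input_values Sigma) ;
  trans := fun x u y =>
    [/\ lattice_points (2 * eta) (state_space Sigma) x,
        lattice_points (2 * mu) (input_values Sigma) u,
        lattice_points (2 * eta) (state_space Sigma) y &
        exists z, [/\ reaches Sigma x (const_input u) tau z,
                      half_open_box eta y z & state_space Sigma z]] |}.


Record store (S I : Type) := Store {
  tr : set (S * I * S) ;
  target : set S ;
  bad : set S }.

Definition source (S I : Type) (T : set (S * I * S)) : set S :=
  [set x | exists u y, T (x, u, y)].

(* Main st         : test of the guard of the main loop;
   Try st x y V    : y is the successor of x in Sq, V the inputs still to try;
   Select st B     : guard of the while loop of NonBlock, with Badx = B;
   Scan st B y Z   : for loop of NonBlock for the selected y, Z the set of the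
                     states z still to be tested;
   Halt A          : termination with output A. *)
Inductive config (S I : Type) :=
| Main of store S I
| Try of store S I & S & S & set I
| Select of store S I & set S
| Scan of store S I & set S & S & set S
| Halt of system S I.

(* step Sp Sq D X0 c k c' : one transition, of cost k. Elements are taken from
   sets in an arbitrary order, hence the nondeterminism. Sq is meant to have at
   most one successor of each state. *)
Inductive step (S I J : Type) (Sp : system S I) (Sq : system S J)
    (D X0 : set S) : config S I -> nat -> config S I -> Prop :=
| step_try st x y w :
    D x -> target st x -> ~ source (tr st) x -> ~ bad st x ->
    trans Sq x w y -> ~ bad st y ->
    step Sp Sq D X0 (Main st) 1 (Try st x y (inputs Sp))
| step_no_succ st x :
    D x -> target st x -> ~ source (tr st) x -> ~ bad st x ->
    (forall w y, trans Sq x w y -> bad st y) ->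
    step Sp Sq D X0 (Main st) 1 (Select st [set x])
| step_halt st :
    (forall x, D x -> target st x -> source (tr st) x \/ bad st x) ->
    step Sp Sq D X0 (Main st) 0
      (Halt (System (source (tr st)) (X0 `&` source (tr st)) (inputs Sp)
               (fun x u y => tr st (x, u, y))))
| step_found st x y V u :
    V u -> trans Sp x u y ->
    step Sp Sq D X0 (Try st x y V) 1
      (Main (Store ((x, u, y) |` tr st) (y |` target st) (bad st)))
| step_next st x y V u :
    V u -> ~ trans Sp x u y ->
    step Sp Sq D X0 (Try st x y V) 1 (Try st x y (V `\ u))
| step_exhausted st x y :
    step Sp Sq D X0 (Try st x y set0) 0 (Select st [set x])
| step_select st B y :
    B y ->
    step Sp Sq D X0 (Select st B) 1 (Scan st B y (source (tr st)))
| step_remove st B y Z z u :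
    Z z -> tr st (z, u, y) ->
    step Sp Sq D X0 (Scan st B y Z) 1
      (Scan (Store (tr st `\ (z, u, y)) (target st) (bad st))
         (z |` B) y (Z `\ z))
| step_keep st B y Z z :
    Z z -> (forall u, ~ tr st (z, u, y)) ->
    step Sp Sq D X0 (Scan st B y Z) 1 (Scan st B y (Z `\ z))
| step_scanned st B y :
    step Sp Sq D X0 (Scan st B y set0) 0
      (Select (Store (tr st) (target st) (y |` bad st)) (B `\ y))
| step_return st :
    step Sp Sq D X0 (Select st set0) 0 (Main st).

Inductive run (S I J : Type) (Sp : system S I) (Sq : system S J)
    (D X0 : set S) : config S I -> nat -> config S I -> Prop :=
| run_nil c : run Sp Sq D X0 c 0 c
| run_cons c1 c2 c3 k l :
    step Sp Sq D X0 c1 k c2 -> run Sp Sq D X0 c2 l c3 ->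
    run Sp Sq D X0 c1 (k + l) c3.

(* Worst-case number of basic steps, over all (complete or partial) executions.
   At most three consecutive transitions have cost 0, so an infinite execution
   would make this +oo. *)
Definition time_complexity (R : realType) (n mp mq : nat)
    (P : control_system R n mp) (Q : control_system R n mq)
    (tau eta mu : R) : \bar R :=
  let Sp := symbolic_system tau eta mu P in
  let Sq := symbolic_system tau eta 0 Q in
  let D := lattice_points (2 * eta) (state_space P `&` state_space Q) in
  let X0 := lattice_points (2 * eta) (init_space P `&` init_space Q) in
  ereal_sup [set k%:R%:E | k in [set k : nat |
    exists c, run Sp Sq D X0 (Main (Store set0 X0 set0)) k c]].

(* Only meaningful for finite sets. *)
Definition set_card (T : choiceType) (A : set T) : nat := #|` fset_set A|.

(* Main.v *)
Require Import Defs.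
From mathcomp Require Import all_boot all_order all_algebra.
From mathcomp Require Import all_classical all_reals all_analysis.
From mathcomp Require Import finmap zify.
Import Order.TTheory GRing.Theory Num.Theory.
Import numFieldNormedType.Exports.
Local Open Scope classical_set_scope.
Local Open Scope ring_scope.

(** Let N and M be the numbers of states in D and of inputs. The lattice points
of a bounded set are finitely many ([finite_lattice_points]), so the question is
purely combinatorial. The bound holds because no state is treated twice. A
state handled by the main loop either becomes a source of T or ends up bad, and
bad is permanent. As only states without outgoing triple are handled, every
source carries exactly one triple; so the scan that deletes a triple turns its
source into a non-source, and a state enters Badx at most once. Hence there are
at most N passes of the main loop, each trying at most M inputs, and at most N
selections in NonBlock, each followed by a scan of at most N sources. This makes
N + N M + N + N^2 steps, which is at most four times the maximum of N M and N^2.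

The count is carried out as an amortized analysis. The potential of a
configuration bounds the work still to come: a state not yet handled is worth
M + N + 2 (one for its pass of the main loop, M for the inputs, N + 1 for its
selection and scan), a source or a member of Badx is worth N + 1, and the loop
in progress is worth the number of its remaining elements. Every transition
lowers the potential by at least its cost ([step_potential]), so the initial
potential bounds the cost of every execution, complete or not. *)

Lemma set_cardD1 {T : choiceType} {A : set T} {x : T} :
  finite_set A -> A x -> set_card A = (set_card (A `\ x)).+1.
Proof.
move=> finA Ax; rewrite /set_card fset_setD1// (cardfsD1 x (fset_set A)).
by rewrite in_fset_set// mem_set.
Qed.

Lemma set_cardU1 {T : choiceType} {A : set T} {x : T} :
  finite_set A -> ~ A x -> set_card (x |` A) = (set_card A).+1.
Proof.
move=> finA nAx; rewrite (@set_cardD1 _ _ x); last by left.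
  by rewrite setUKD // => z [->].
by rewrite finite_setU; split.
Qed.

Lemma subset_set_card {T : choiceType} {A B : set T} :
  finite_set B -> A `<=` B -> (set_card A <= set_card B)%N.
Proof.
move=> finB AB; have finA := sub_finite_set AB finB.
by apply: fsubset_leq_card; rewrite -fset_set_sub.
Qed.

Lemma source_insert {S I : Type} (T : set (S * I * S)) x u y :
  source ((x, u, y) |` T) = x |` source T.
Proof.
rewrite eqEsubset; split=> z /=.
  by move=> [v [t [[-> _ _]|Tz]]]; [left|right; exists v, t].
by move=> [->|[v [t Tz]]]; [exists u, y; left|exists v, t; right].
Qed.

Definition functional_on_sources {S I : Type} (T : set (S * I * S)) : Prop :=
  forall z u y u' y', T (z, u, y) -> T (z, u', y') -> u = u' /\ y = y'.

(** Uniqueness of the outgoing triple is what makes a deletion in NonBlock remove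
the state from the sources, so that it cannot be handed to Badx a second time. *)
Lemma source_remove {S I : Type} {T : set (S * I * S)} {z u y} :
  functional_on_sources T -> T (z, u, y) ->
  source (T `\ (z, u, y)) = source T `\ z.
Proof.
move=> funT Tz; rewrite eqEsubset; split=> t /=.
  move=> [v [s [Tt nt]]]; split; first by exists v, s.
  by move=> tz; subst t; have [uv ys] := funT _ _ _ _ _ Tz Tt; subst; apply: nt.
move=> [[v [s Tt]] nt]; exists v, s; split=> //.
by move=> [tz _ _]; apply: nt.
Qed.

Definition store_inv {S I : Type} (D : set S) (st : store S I) : Prop :=
  source (tr st) `<=` D /\ functional_on_sources (tr st).

(** The members of Badx are kept apart from the sources, so that taking a scanned
state out of Badx takes it out of their union, which the potential counts. *)
Definition config_inv {S I : Type} (D : set S) (c : config S I) : Prop :=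
  match c with
  | Main st => store_inv D st
  | Try st x _ V =>
      [/\ store_inv D st, D x, ~ source (tr st) x & finite_set V]
  | Select st B =>
      [/\ store_inv D st, B `<=` D & forall z, B z -> ~ source (tr st) z]
  | Scan st B y Z =>
      [/\ store_inv D st, B `<=` D, forall z, B z -> ~ source (tr st) z,
          B y & Z `<=` D]
  | Halt _ => True
  end.

(** Inside Try the state at hand, and inside NonBlock the members of Badx, may
still belong to this set; the potential takes them out. *)
Definition unprocessed {S I : Type} (D : set S) (st : store S I) : set S :=
  D `\` (source (tr st) `|` bad st).

(** In Try the state at hand is worth the N + 1 of its possible selection plus
the inputs still to be tried; in Scan the selected state y has paid for its own
selection, and its N remaining units are replaced by the pairs still to be
tested. *)
Definition potential {S I : choiceType} (D : set S) (M : nat)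
    (c : config S I) : nat :=
  let N := set_card D in
  let credit (F L : set S) (r : nat) :=
    ((M + N + 2) * set_card F + (N + 1) * set_card L + r)%N in
  match c with
  | Main st => credit (unprocessed D st) (source (tr st)) 0
  | Try st x _ V =>
      credit (unprocessed D st `\ x) (source (tr st)) (set_card V + N + 1)
  | Select st B => credit (unprocessed D st `\` B) (source (tr st) `|` B) 0
  | Scan st B y Z =>
      credit (unprocessed D st `\` B) ((source (tr st) `|` B) `\ y)
        (set_card Z)
  | Halt _ => 0
  end%N.

(** The amortized cost of every transition is nonpositive. Each case compares the
sets of unprocessed states and of sources or members of Badx before and after:
they lose one element, pass one from the first to the second, or stay the same.
In particular deleting a triple only moves its source to Badx, leaving the union
unchanged, so that the test is paid by the scan alone. *)
Lemma step_potential {S I : choiceType} {J : Type} {Sp : system S I}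
    {Sq : system S J} {D X0 : set S} {c c' : config S I} {k : nat} :
  finite_set D -> finite_set (inputs Sp) ->
  step Sp Sq D X0 c k c' -> config_inv D c ->
  config_inv D c' /\
  (k + potential D (set_card (inputs Sp)) c'
     <= potential D (set_card (inputs Sp)) c)%N.
Proof.
move=> finD finU.
have finF (st : store S I) B : finite_set (unprocessed D st `\` B).
  by apply: sub_finite_set finD => z [[]].
have finF0 (st : store S I) : finite_set (unprocessed D st).
  by rewrite -(setD0 (unprocessed D st)).
have finS (st : store S I) : store_inv D st -> finite_set (source (tr st)).
  by move=> [sD _]; apply: sub_finite_set finD.
case=> {c c' k}.
- move=> st x y w Dx _ nsx nbx _ _ /= ok; split=> //.
  have Fx : unprocessed D st x by split=> // -[].
  by rewrite (set_cardD1 (finF0 st) Fx); lia.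
- move=> st x Dx _ nsx nbx _ /= ok; split.
    by split=> // [z ->|z ->].
  have Fx : unprocessed D st x by split=> // -[].
  rewrite (set_cardD1 (finF0 st) Fx).
  by rewrite setUC (set_cardU1 (finS _ ok) nsx); lia.
- by [].
- move=> st x y V u Vu _ /= [[sD funT] Dx nsx finV]; split.
    split; rewrite /= ?source_insert; first by move=> z [->|/sD].
    move=> z v t v' t' /= [[zx vu ty]|Tz] [[zx' vu' ty']|Tz'].
    + by rewrite vu vu' ty ty'.
    + by exfalso; apply: nsx; exists v', t'; rewrite -zx.
    + by exfalso; apply: nsx; exists v, t; rewrite -zx'.
    + exact: funT Tz Tz'.
  rewrite /unprocessed /= source_insert setDDl -(setUC [set x]) -setUA.
  rewrite (set_cardU1 (finS _ (conj sD funT)) nsx).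
  rewrite (set_cardD1 finV Vu).
  by lia.
- move=> st x y V u Vu _ /= [ok Dx nsx finV]; split.
    by split=> //; apply: finite_setD.
  by rewrite (set_cardD1 finV Vu); lia.
- move=> st x y /= [ok Dx nsx _]; split.
    by split=> // [z ->|z ->].
  by rewrite (setUC _ [set x]) (set_cardU1 (finS _ ok) nsx); lia.
- move=> st B y By /= [[sD funT] BD dis]; split; first by split.
  (* The N units released by y must pay for the scan of all sources. *)
  have le := subset_set_card finD sD.
  have fin : finite_set (source (tr st) `|` B).
    by apply: sub_finite_set finD => z [/sD|/BD].
  by rewrite (set_cardD1 fin (or_intror By)); lia.
- move=> st B y Z z u Zz Tz /= [[sD funT] BD dis By ZD].
  have sz : source (tr st) z by exists u, y.
  have sE := source_remove funT Tz; split.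
    split=> //=.
    + split; first by rewrite /= sE => t [/sD].
      by move=> t v s v' s' [Tt _] [Tt' _]; apply: funT Tt Tt'.
    + by move=> t [->|/BD//]; apply: ZD.
    + by move=> t [->|/dis nt]; rewrite sE => -[tT]; [apply|have := nt tT].
    + by right.
    + by move=> t [/ZD].
  have finZ := sub_finite_set ZD finD.
  (* z leaves the sources for Badx: both parts of the potential keep their set. *)
  have -> : unprocessed D (Store (tr st `\ (z, u, y)) (target st) (bad st))
      `\` (z |` B) = unprocessed D st `\` B.
    by rewrite /unprocessed /= sE !setDDl setUACA (setUC _ [set z])
      setD1K// setUA.
  rewrite sE setUA (setUC _ [set z]) setD1K//.
  by rewrite (set_cardD1 finZ Zz); lia.
- move=> st B y Z z Zz _ /= [ok BD dis By ZD]; split.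
    by split=> // t [/ZD].
  by rewrite (set_cardD1 (sub_finite_set ZD finD) Zz); lia.
- move=> st B y /= [ok BD dis By _]; split.
    by split=> [|t [] /BD|t [] /dis].
  have nsy := dis _ By.
  (* y passes from Badx to Bad, so the first part is unchanged; the second one
     already omits y, which is not a source. *)
  have -> : unprocessed D (Store (tr st) (target st) (y |` bad st)) `\` (B `\ y)
      = unprocessed D st `\` B.
    rewrite /unprocessed /= !setDDl (setUC [set y]) setUA -setUA.
    by rewrite setD1K.
  rewrite setDUD (@not_setD1 _ y (source (tr st)))//.
  by lia.
- by move=> st /= [ok _ _]; split=> //; rewrite setD0 setU0.
Qed.

Lemma run_potential {S I : choiceType} {J : Type} {Sp : system S I}
    {Sq : system S J} {D X0 : set S} {c c' : config S I} {k : nat} :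
  finite_set D -> finite_set (inputs Sp) ->
  run Sp Sq D X0 c k c' -> config_inv D c ->
  (k <= potential D (set_card (inputs Sp)) c)%N.
Proof.
move=> finD finU; elim=> {c c' k} // c1 c2 c3 k l s12 _ IH inv1.
have [/IH] := step_potential finD finU s12 inv1.
by lia.
Qed.

Lemma run_cost_bound {S I : choiceType} {J : Type} {Sp : system S I}
    {Sq : system S J} {D X0 : set S} {c : config S I} {k : nat} :
  finite_set D -> finite_set (inputs Sp) ->
  run Sp Sq D X0 (Main (Store set0 X0 set0)) k c ->
  (k <= 4 * maxn (set_card D * set_card (inputs Sp)) (set_card D ^ 2))%N.
Proof.
move=> finD finU r.
have source0 : source (set0 : set (S * I * S)) = set0.
  by rewrite -subset0 => z [u [y]].
have inv0 : config_inv D (Main (Store set0 X0 set0) : config S I).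
  by split; rewrite /= ?source0.
have := run_potential finD finU r inv0.
rewrite /= /unprocessed /= source0 setU0 setD0.
rewrite /(set_card set0) fset_set0 cardfs0.
set N := set_card D; set M := set_card _ => kle.
(* The terms 2 N are absorbed by N^2, as N <= N^2 for a natural number N. *)
apply: leq_trans kle _; nia.
Qed.

(** A lattice point is determined by its integer coordinates, and these are at
most K / h in absolute value when the norm is at most K. *)
Lemma finite_lattice_points {R : realType} {n : nat} {h : R}
    {A : set 'rV[R]_n} :
  0 < h -> bounded_set A -> finite_set (lattice_points h A).
Proof.
move=> h0 /pinfty_ex_gt0[K K0 AK].
pose N := (Num.trunc (K / h)).+1.
(* Coordinates from - N to N, encoded as ordinals by the shift by N. *)
pose grid (f : {ffun 'I_n -> 'I_N.*2.+1}) : 'rV[R]_n :=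
  \row_i (((f i : nat)%:Z - N%:Z)%:~R * h).
apply: (@sub_finite_set _ _ (grid @` setT)); last first.
  by apply: finite_image; apply: finite_finset.
move=> a [Aa /choice[k ak]].
have kN i : (`|k i| <= N%:Z)%R.
  have aK : `|a ord0 i| <= K.
    apply: le_trans (AK a Aa).
    rewrite [leRHS]mx_normrE.
    exact: (le_bigmax _ (fun ij => `|a ij.1 ij.2|) (ord0, i)).
  have : `|k i|%:~R <= K / h.
    by rewrite ler_pdivlMr// intr_norm -{1}(gtr0_norm h0) -normrM -ak.
  move=> /le_lt_trans/(_ (truncnS_gt _)).
  by rewrite -[ltRHS]/((N%:Z)%:~R) ltr_int => /ltW.
exists [ffun i => inord (absz (k i + N%:Z))] => //.
apply/rowP => i; rewrite mxE ffunE inordK ?ak; last by have := kN i; lia.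
by congr (_%:~R * h); have := kN i; lia.
Qed.

Theorem proposition6p4 :
  exists C : nat,
  forall (R : realType) (n mp mq : nat)
    (P : control_system R n mp) (Q : control_system R n mq)
    (beta_p beta_q : R -> R -> R) (gamma_p gamma_q : R -> R)
    (eps theta_p theta_q tau eta mu : R),
  autonomous Q ->
  bounded_set (state_space P) -> bounded_set (input_values P) ->
  bounded_set (state_space Q) ->
  delta_ISS_with P beta_p gamma_p ->
  delta_ISS_with Q beta_q gamma_q ->
  0 < eps -> 0 < theta_p -> 0 < theta_q -> 0 < tau -> 0 < eta -> 0 < mu ->
  theta_p + theta_q <= eps ->
  beta_p theta_p tau + gamma_p mu + eta <= theta_p ->
  beta_q theta_q tau + eta <= theta_q ->
  (time_complexity P Q tau eta mu <=
   (C * maxn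
      (set_card (lattice_points (2 * eta) (state_space Q `&` state_space P)) *
       set_card (lattice_points (2 * mu) (input_values P)))
      (set_card (lattice_points (2 * eta) (state_space Q `&` state_space P)) ^ 2))%:R%:E)%E.
Proof.
exists 4%N => R n mp mq P Q beta_p beta_q gamma_p gamma_q eps theta_p theta_q
  tau eta mu _ bP bU _ _ _ _ _ _ _ eta0 mu0 _ _ _.
rewrite (setIC (state_space Q)); apply: ge_ereal_sup => _ [k [c r] <-].
rewrite lee_fin ler_nat; apply: run_cost_bound r.
  apply: finite_lattice_points; first by rewrite mulr_gt0.
  by apply: sub_boundedr bP => B; apply: subset_trans; apply: subIsetl.
by apply: finite_lattice_points => //; rewrite mulr_gt0.
Qed.
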